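(* Let $X$ and $Y$ be topological spaces and $f:X\to Y$ an injection that is pre $e^*\theta$-closed and strongly $e^*$-irresolute. If $Y$ is $(e^*,\theta)^*$-normal, then $X$ is $(e^*,\theta)^*$-normal.
   Context: For a subset $A$ of a topological space $X$, $cl(A)$ and $int(A)$ denote closure and interior. The $\delta$-closure $cl_\delta(A)$ is the set of points $x\in X$ such that $int(cl(U))\cap A\neq\emptyset$ for every open $U$ containing $x$. $A$ is $e^*$-open if $A\subseteq cl(int(cl_\delta(A)))$; complements of $e^*$-open sets are $e^*$-closed; $e^*\text{-}cl(A)$ is the intersection of all $e^*$-closed sets containing $A$. The $e^*$-$\theta$-closure $e^*\text{-}cl_\theta(A)$ is the set of points $x\in X$ such that $e^*\text{-}cl(U)\cap A\neq\emptyset$ for every $e^*$-open set $U$ containing $x$. $A$ is $e^*$-$\theta$-closed if $A=e^*\text{-}cl_\theta(A)$; complements of $e^*$-$\theta$-closed sets are called $e^*$-$\theta$-open. A function $f:X\to Y$ is pre $e^*\theta$-closed if the image of each $e^*$-$\theta$-closed set of $X$ is $e^*$-$\theta$-closed in $Y$. It is strongly $e^*$-irresolute if for each $x\in X$ and each $e^*$-open set $V$ of $Y$ containing $f(x)$ there exists an $e^*$-open set $U$ of $X$ containing $x$ such that $f[e^*\text{-}cl(U)]\subseteq V$. A space is $(e^*,\theta)^*$-normal if for any pair of disjoint $e^*$-$\theta$-closed sets $F_1$ and $F_2$ there exist disjoint $e^*$-$\theta$-open sets $U_1$ and $U_2$ with $F_1\subseteq U_1$ and $F_2\subseteq U_2$.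 *)

(* Defs.v *)
(* A [topologicalType] has neither a distinguished point nor any separation
   axiom, so the spaces below are arbitrary and possibly empty. *)
From mathcomp Require Import all_boot.
From mathcomp Require Import classical_sets topology.

Set Implicit Arguments.
Unset Strict Implicit.
Unset Printing Implicit Defensive.

Local Open Scope classical_set_scope.

Section EstarSets.
Variable X : topologicalType.
Implicit Types A U : set X.

Definition delta_closure A : set X :=
  [set x | forall U, open U -> U x ->
    interior (closure U) `&` A !=set0].

Definition estar_open A : Prop :=
  A `<=` closure (interior (delta_closure A)).

Definition estar_closed A : Prop := estar_open (~` A).

(* [smallest C A] is the intersection of all sets containing A that
   satisfy C. *)
Definition estar_closure A : set X := smallest estar_closed A.

Definition estar_theta_closure A : set X :=
  [set x | forall U, estar_open U -> U x -> estar_closure U `&` A !=set0].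

Definition estar_theta_closed A : Prop := A = estar_theta_closure A.

Definition estar_theta_open A : Prop := estar_theta_closed (~` A).

End EstarSets.

Definition pre_estar_theta_closed (X Y : topologicalType) (f : X -> Y) : Prop :=
  forall F : set X, estar_theta_closed F -> estar_theta_closed (f @` F).

Definition strongly_estar_irresolute (X Y : topologicalType) (f : X -> Y)
  : Prop :=
  forall (x : X) (V : set Y), estar_open V -> V (f x) ->
    exists U : set X,
      [/\ estar_open U, U x & f @` estar_closure U `<=` V].

Definition estar_theta_star_normal (X : topologicalType) : Prop :=
  forall F1 F2 : set X,
    estar_theta_closed F1 -> estar_theta_closed F2 -> F1 `&` F2 = set0 ->
    exists U1 U2 : set X,
      [/\ estar_theta_open U1, estar_theta_open U2, U1 `&` U2 = set0,
          F1 `<=` U1 & F2 `<=` U2].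

(* Main.v *)
Require Import Defs.
From mathcomp Require Import all_boot.
From mathcomp Require Import classical_sets topology.

Local Open Scope classical_set_scope.

(** Disjoint [F1], [F2] are pushed forward to [Y], separated there and pulled back. Injectivity
    keeps the images disjoint and [f_closed] keeps them e*-theta-closed, so normality of [Y]
    applies; the preimages of the separating sets work in [X] by [estar_theta_closed_preimage], used
    on complements. *)

Lemma subset_estar_closure (X : topologicalType) (A : set X) :
  A `<=` estar_closure A.
Proof. exact: sub_gen_smallest. Qed.

(** Irresoluteness maps the whole e*-closure of some [U] around [x] into a given [V] around [f x]. A
    point where that closure meets the preimage of [C] is thus sent into both [V] and [C]. *)
Lemma estar_theta_closed_preimage (X Y : topologicalType) (f : X -> Y) :
  strongly_estar_irresolute f ->
  forall C : set Y, estar_theta_closed C -> estar_theta_closed (f @^-1` C).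
Proof.
move=> f_irr C C_closed; apply/seteqP; split => [x Cfx U _ Ux | x x_cl].
  by exists x; split => //; apply: subset_estar_closure.
(* Membership of [f x] in [C] is turned into membership in its theta-closure, to be tested on each
   e*-open [V]. *)
rewrite /preimage /= C_closed => V V_open Vfx.
have [U [U_open Ux fU_V]] := f_irr x V V_open Vfx.
have [z [Uz Cfz]] := x_cl U U_open Ux.
by exists (f z); split => //; apply: subset_estar_closure; apply: fU_V; exists z.
Qed.

Theorem theorem16 (X Y : topologicalType) (f : X -> Y)
  (f_inj : injective f)
  (f_closed : pre_estar_theta_closed f)
  (f_irr : strongly_estar_irresolute f)
  (Y_normal : estar_theta_star_normal Y) :
  estar_theta_star_normal X.
Proof.
move=> F1 F2 F1_closed F2_closed F12.
have fF12 : f @` F1 `&` f @` F2 = set0.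
  rewrite -subset0 => _ [[x F1x <-] [y F2y /f_inj yx]].
  have : (F1 `&` F2) x by split; rewrite // -yx.
  by rewrite F12.
have [V1 [V2 [V1_open V2_open V12 FV1 FV2]]] :=
  Y_normal _ _ (f_closed _ F1_closed) (f_closed _ F2_closed) fF12.
exists (f @^-1` V1), (f @^-1` V2); split.
- by rewrite /estar_theta_open preimage_setC; apply: estar_theta_closed_preimage.
- by rewrite /estar_theta_open preimage_setC; apply: estar_theta_closed_preimage.
- by rewrite -preimage_setI V12 preimage_set0.
- by move=> x F1x; apply: FV1; exists x.
- by move=> x F2x; apply: FV2; exists x.
Qed.
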